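(* Let $\mathcal S=(\mathcal M,X,\bot)$ be an accessible concurrent system. Then $\mathcal S$ is irreducible if and only if $\mathcal S$ has the spectral property, i.e. for every letter $a$ of the base alphabet $\Sigma$ of $\mathcal M$, the characteristic root $r^a$ of the concurrent system $(\mathcal M^a,X,\bot)$ satisfies $r^a>r$, where $r$ is the characteristic root of $\mathcal S$.
   Context: A trace monoid $\mathcal M=\mathcal M(\Sigma,I)$ is the monoid presented by $\langle\Sigma\mid ab=ba \text{ for all }(a,b)\in I\rangle$, where $\Sigma$ is a finite alphabet and $I\subseteq\Sigma\times\Sigma$ is irreflexive and symmetric; its elements are called traces, $\varepsilon$ is the unit, and $|x|$ is the length of a trace $x$. Let $D=(\Sigma\times\Sigma)\setminus I$; $\mathcal M$ is irreducible if the graph $(\Sigma,D)$ is connected. For $a\in\Sigma$, $\mathcal M^a=\langle\Sigma\setminus\{a\}\rangle$ is the submonoid generated by $\Sigma\setminus\{a\}$ (traces with no occurrence of $a$). A concurrent system is a triple $(\mathcal M,X,\bot)$ where $X$ is a finite set of states, $\bot\notin X$, and $\mathcal M$ acts on the right on $X\cup\{\bot\}$ (so $\alpha\cdot\varepsilon=\alpha$, $(\alpha\cdot x)\cdot y=\alpha\cdot(xy)$) with $\bot\cdot x=\bot$ for all $x$. A trace $x$ is an execution from $\alpha\in X$ if $\alpha\cdot x\neq\bot$. The system is accessible if for all $\alpha,\beta\in X$ there is $x$ with $\alpha\cdot x=\beta$; alive if for every $\alpha\in X$ and every $a\in\Sigma$ there is $x\in\mathcal M$ containing at least one occurrence of $a$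 with $\alpha\cdot x\neq\bot$; irreducible if it is accessible, alive, and $\mathcal M$ is irreducible. For $\alpha,\beta\in X$, let $\mathcal M_{\alpha,\beta}(n)=\{x\in\mathcal M:\ |x|=n,\ \alpha\cdot x=\beta\}$, $G_{\alpha,\beta}(z)=\sum_{n\ge0}\#\mathcal M_{\alpha,\beta}(n)z^n$ with radius of convergence $r_{\alpha,\beta}\in(0,+\infty]$. The characteristic root of the system is $r=\min_{\alpha,\beta\in X}r_{\alpha,\beta}$ (possibly $+\infty$). For $a\in\Sigma$, $(\mathcal M^a,X,\bot)$ is the concurrent system obtained by restricting the action to $\mathcal M^a$. *)

(* Defs.v *)
From HB Require Import structures.
From mathcomp Require Import all_boot all_order all_algebra all_fingroup.
From mathcomp Require Import all_classical all_reals all_analysis.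
Set Implicit Arguments. Unset Strict Implicit. Unset Printing Implicit Defensive.
Import Order.TTheory GRing.Theory Num.Theory.
Import numFieldNormedType.Exports.
Local Open Scope classical_set_scope.
Local Open Scope ring_scope.

Section Traces.
Variable Sigma : finType.
(* independence relation I (assumed irreflexive and symmetric in the theorem) *)
Variable I : rel Sigma.

Definition tswap (n : nat) (w1 w2 : n.-tuple Sigma) : bool :=
  [exists i : 'I_n, exists j : 'I_n,
     [&& (nat_of_ord j == (nat_of_ord i).+1)%N,
         I (tnth w1 i) (tnth w1 j)
       & [forall k, tnth w2 k == tnth w1 (tperm i j k)]]].

(* trace equivalence on words of length n: the congruence generated by
   ab = ba for (a,b) in I *)
Definition trace_eq (n : nat) : rel (n.-tuple Sigma) := connect (@tswap n).

Definition irreducible_monoid : Prop :=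
  forall a b : Sigma, connect (fun x y => ~~ I x y) a b.

Variable X : finType.
(* action of generators on X + {bot}, with bot represented by None *)
Variable d : Sigma -> option X -> option X.

Definition act (s : option X) (w : seq Sigma) : option X :=
  foldl (fun s a => d a s) s w.

(* number of traces of length n, all of whose letters satisfy P
   (i.e. traces of the submonoid generated by P), with alpha . x = beta:
   number of trace-equivalence classes of such words *)
Definition ntraces (P : pred Sigma) (alpha beta : X) (n : nat) : nat :=
  #|equivalence_partition (@trace_eq n)
      [set w : n.-tuple Sigma | all P w && (act (Some alpha) w == Some beta)]|.

Definition accessible : Prop :=
  forall alpha beta : X, exists w : seq Sigma, act (Some alpha) w = Some beta.

Definition alive : Prop :=
  forall (alpha : X) (a : Sigma), exists w : seq Sigma,
    a \in w /\ act (Some alpha) w <> None.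

Definition irreducible_system : Prop :=
  [/\ accessible, alive & irreducible_monoid].

End Traces.

Definition radius (R : realType) (c : nat -> nat) : \bar R :=
  ereal_sup [set (rho%:E) | rho in
     [set rho : R | 0 <= rho /\ cvg (series (fun n => (c n)%:R * rho ^+ n) @ \oo)]].

(* characteristic root of the system restricted to the submonoid generated by
   the letters satisfying P : min over alpha, beta of r_{alpha,beta} *)
Definition char_root (R : realType) (Sigma : finType) (I : rel Sigma)
  (X : finType) (d : Sigma -> option X -> option X) (P : pred Sigma) : \bar R :=
  \big[Order.min/+oo%E]_(p : X * X) radius R (ntraces I d P p.1 p.2).

Definition spectral_property (R : realType) (Sigma : finType) (I : rel Sigma)
  (X : finType) (d : Sigma -> option X -> option X) : Prop :=
  forall a : Sigma,
    (char_root R I d predT < char_root R I d (fun b => b != a))%E.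

(* Main.v *)
Require Import Defs.
From HB Require Import structures.
From mathcomp Require Import all_boot all_order all_algebra all_fingroup.

(** If the spectral property holds, every letter occurs in some execution, hence
    by accessibility in some execution from each state. If the alphabet were
    a union of two nonempty mutually independent parts, every trace would be a
    product of one trace from each part; each generating function of the system
    would then be dominated by a sum of products of generating functions of
    subsystems omitting some letter, and would converge beyond [r].

    Conversely, let the system be irreducible. The total number of [a]-free
    executions of length [n] is submultiplicative in [n], so its generating
    function diverges at the radius [r^a]; hence so does that of the [a]-free
    executions [x] from some [ga] to some [de]. By aliveness and connectedness of
    the dependence graph there is a path [p y z] from [de] back to [ga] with [p]
    free of [a], and with [y] containing all letters and lying entirely above its
    first [a]. In a trace [x p y z r] the part [x p] is then exactly what does not
    lie above the first [a], so the trace determines [x] and [r]. Hence the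
    generating function [G] of the loops at [ga] satisfies the renewal inequality
    [G >= 1 + t^|pyz| F G], where [F] counts the [x], so it diverges as soon
    as [t^|pyz| F >= 1], which happens for some [t < r^a]. *)

(** * Words up to commutation *)

Section TraceWords.
Set Implicit Arguments.
Unset Strict Implicit.
Variables (Sigma : finType) (I : rel Sigma).
Hypotheses (I_irrefl : irreflexive I) (I_sym : symmetric I).
Implicit Types (u v w s t : seq Sigma) (C : {set Sigma}).

(** Chains of swaps on words of any length, free of the tuple type of [trace_eq]; [trace_eqP]
    identifies the two. *)
Inductive tr : seq Sigma -> seq Sigma -> Prop :=
| tr_refl w : tr w w
| tr_step s e f t w : I e f -> tr (s ++ f :: e :: t) w -> tr (s ++ e :: f :: t) w.

Lemma tr_trans v u w : tr u v -> tr v w -> tr u w.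
Proof. by elim=> // s e f t w' Ief _ IH /IH; apply: tr_step. Qed.

Lemma tr_sym u v : tr u v -> tr v u.
Proof.
elim=> [w|s e f t w Ief _ IH]; first exact: tr_refl.
apply: tr_trans IH _; apply: tr_step; first by rewrite I_sym.
exact: tr_refl.
Qed.

Lemma tr_catl s u v : tr u v -> tr (s ++ u) (s ++ v).
Proof.
elim=> [w|s' e f t w Ief _ IH]; first exact: tr_refl.
by rewrite catA; apply: tr_step => //; rewrite -catA.
Qed.

Lemma tr_catr s u v : tr u v -> tr (u ++ s) (v ++ s).
Proof.
elim=> [w|s' e f t w Ief _ IH]; first exact: tr_refl.
by rewrite -catA /=; apply: tr_step => //; move: IH; rewrite -catA.
Qed.

Lemma tr_cat u u' v v' : tr u u' -> tr v v' -> tr (u ++ v) (u' ++ v').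
Proof. by move=> h k; apply: tr_trans (tr_catr v h) (tr_catl u' k). Qed.

Lemma tr_perm u v : tr u v -> perm_eq u v.
Proof.
elim=> [w|s e f t w Ief _ IH]; first exact: perm_refl.
apply: perm_trans IH; rewrite perm_cat2l.
by rewrite -[e :: _]/([:: e] ++ [:: f] ++ t) perm_catCA.
Qed.

Lemma tr_size u v : tr u v -> size u = size v.
Proof. by move/tr_perm/perm_size. Qed.

Lemma tr_move_front e s t : {in s, forall x, I e x} ->
  tr (s ++ e :: t) (e :: s ++ t).
Proof.
elim: s => [|x s IH] h /=; first exact: tr_refl.
apply: (@tr_trans (x :: e :: s ++ t)).
  by apply: (@tr_catl [:: x]); apply: IH => y ys; apply: h; rewrite inE ys orbT.
apply: (@tr_step [::]); last exact: tr_refl.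
by rewrite I_sym h // mem_head.
Qed.

(* Traces are determined by their projections on pairs of dependent letters;
   cancellation is immediate in this form. *)
Definition teq u v := forall b c, ~~ I b c ->
  filter (pred2 b c) u = filter (pred2 b c) v.

Lemma tr_teq u v : tr u v -> teq u v.
Proof.
elim=> [//|s e f t w Ief _ IH] b c nI; rewrite -(IH b c nI) !filter_cat /=.
congr (_ ++ _).
case eb: (_ || _); case fb: (_ || _) => //.
suff: ~~ I e f by rewrite Ief.
by case/orP: eb => /eqP->; case/orP: fb => /eqP->; rewrite ?I_irrefl // I_sym.
Qed.

(** By irreflexivity the pair of [x] with itself is dependent, so its projection counts the letter
    [x]. *)
Lemma teq_perm u v : teq u v -> perm_eq u v.
Proof.
move=> h; apply/allP => x _; apply/eqP; rewrite -!size_filter.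
have F w : [seq y <- w | pred1 x y] = [seq y <- w | pred2 x x y].
  by apply: eq_filter => y /=; rewrite orbb.
by rewrite !F (h x x) // I_irrefl.
Qed.

Lemma teq_cancel_l s u v : teq (s ++ u) (s ++ v) -> teq u v.
Proof.
move=> h b c nI; have := h b c nI; rewrite !filter_cat.
by move/eqP; rewrite eqseq_cat // eqxx => /eqP.
Qed.

Lemma teq_cancel_r s u v : teq (u ++ s) (v ++ s) -> teq u v.
Proof.
move=> h b c nI; have := h b c nI; rewrite !filter_cat => E.
have /eqP := E; rewrite eqseq_cat ?eqxx ?andbT; first by move/eqP.
by have := congr1 size E; rewrite !size_cat => /addIn.
Qed.

Lemma split_first (e : Sigma) v : e \in v ->
  exists s t, v = s ++ e :: t /\ e \notin s.
Proof.
elim: v => // x v IH; rewrite inE; have [->|ne /= /IH[s [t [-> es]]]] := eqVneq e x.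
  by exists [::], v.
by exists (x :: s), t; split; rewrite // inE negb_or ne.
Qed.

(** Induction on [u]: its first letter [e] commutes with everything before the first [e] of [v], so
    that occurrence can be moved to the front and removed. *)
Lemma teq_tr u v : teq u v -> tr u v.
Proof.
elim: u v => [|e u IH] v h.
  by have /perm_size/esym/size0nil -> := teq_perm h; exact: tr_refl.
have ev : e \in v by rewrite -(perm_mem (teq_perm h)) mem_head.
have [s [t [ev' es]]] := split_first ev; subst v.
(* If [x] depended on [e], the two projections on this pair would start differently: one with [e],
   the other with a letter of [s], which is not [e]. *)
have Is : {in s, forall x, I e x}.
  move=> x xs; apply/negPn/negP => nI; have := h e x nI.
  rewrite filter_cat /= eqxx.
  have : all (predC1 e) [seq y <- s | pred2 e x y].
    apply/allP => y; rewrite mem_filter => /andP[_ ys] /=.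
    by apply: contraNneq es => <-.
  have : x \in [seq y <- s | pred2 e x y] by rewrite mem_filter /= eqxx orbT.
  by case: filter => // y s' _ /= /andP[/negP ye _] [/esym/eqP].
apply: tr_trans (tr_sym (tr_move_front t Is)).
apply: (@tr_catl [:: e]); apply: IH => b c nI; have := h b c nI.
rewrite !filter_cat /=; case: ifP => // eb.
(* Here [e] is [b] or [c]; a letter of [s] in this pair would be the other one, hence dependent on
   [e], against [Is]. *)
suff -> : [seq y <- s | pred2 b c y] = [::] by move=> [].
apply/eqP; rewrite -(negbK (_ == _)) -has_filter; apply/hasPn => y ys /=.
apply: contraNN nI => yb.
have ye : y != e by apply: contraNneq es => <-.
have := Is _ ys; case/orP: eb yb => /eqP Ee; case/orP => /eqP Ey; subst.
- by rewrite eqxx in ye.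
- by [].
- by rewrite I_sym.
- by rewrite eqxx in ye.
Qed.

Lemma tr_cancel_l s u v : tr (s ++ u) (s ++ v) -> tr u v.
Proof. by move/tr_teq/teq_cancel_l/teq_tr. Qed.

Lemma tr_cancel_r s u v : tr (u ++ s) (v ++ s) -> tr u v.
Proof. by move/tr_teq/teq_cancel_r/teq_tr. Qed.

Lemma tr_filter_split (p : pred Sigma) w :
  (forall x y, p x -> ~~ p y -> I x y) ->
  tr w ([seq x <- w | p x] ++ [seq x <- w | ~~ p x]).
Proof.
move=> Ip; elim: w => [|e w IH] /=; first exact: tr_refl.
case: ifP => pe /=; first exact: (@tr_catl [:: e]).
apply: tr_trans (@tr_catl [:: e] _ _ IH) _; apply: tr_sym.
apply: tr_move_front => x; rewrite mem_filter I_sym => /andP[px _].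
by apply: Ip; rewrite ?pe.
Qed.

(** * Agreement with [trace_eq], and canonical words *)

Lemma tswap_split n (w1 w2 : n.-tuple Sigma) : tswap I w1 w2 ->
  exists s e f t, [/\ I e f, val w1 = s ++ e :: f :: t
                    & val w2 = s ++ f :: e :: t].
Proof.
move=> /existsP[i /existsP[j /and3P[/eqP ji Iij /forallP w2E]]].
pose x0 := tnth w1 i.
exists (take i w1), (tnth w1 i), (tnth w1 j), (drop j.+1 w1).
have iw : i < size w1 by rewrite size_tuple.
have jw : i.+1 < size w1 by rewrite -ji size_tuple.
have w1E : val w1 = take i w1 ++ tnth w1 i :: tnth w1 j :: drop j.+1 w1.
  rewrite -[LHS](cat_take_drop i) (drop_nth x0 iw) (drop_nth x0 jw).
  by rewrite !(tnth_nth x0) /= ji.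
split=> //; apply: (@eq_from_nth _ x0).
  have := congr1 size w1E; rewrite (size_tuple w1) (size_tuple w2) => {1}->.
  by rewrite !size_cat.
move=> k; rewrite size_tuple => kn.
have /eqP := w2E (Ordinal kn); rewrite (tnth_nth x0) /= => ->.
have si : size (take i w1) = i by rewrite size_take iw.
have k1 : nth x0 w1 k = nth x0 (take i w1 ++ tnth w1 i :: tnth w1 j :: drop j.+1 w1) k.
  by rewrite -w1E.
case: tpermP => [/(congr1 val)/= ->|/(congr1 val)/= ->|/eqP ki /eqP kj].
- by rewrite nth_cat si ltnn subnn.
- by rewrite ji nth_cat si ltnNge leqnSn /= subSnn.
rewrite (tnth_nth x0) /= k1 !nth_cat si; case: ltnP => // ik.
have {}ki : k != i by apply: contraNneq ki => E; apply/eqP/val_inj.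
have {}kj : k != i.+1 by apply: contraNneq kj => E; apply/eqP/val_inj; rewrite /= ji.
have : i.+1 < k by rewrite ltn_neqAle eq_sym kj ltn_neqAle eq_sym ki.
by move=> lt; rewrite -(subnSK (ltnW lt)) -(subnSK lt).
Qed.

Lemma split_tswap n (w1 w2 : n.-tuple Sigma) s e f t : I e f ->
  val w1 = s ++ e :: f :: t -> val w2 = s ++ f :: e :: t -> tswap I w1 w2.
Proof.
move=> Ief E1 E2.
have nE : n = size s + (size t).+2 by rewrite -(size_tuple w1) E1 size_cat.
have ni : size s < n by rewrite nE -addSnnS leq_addr.
have nj : (size s).+1 < n by rewrite nE -!addSnnS leq_addr.
apply/existsP; exists (Ordinal ni); apply/existsP; exists (Ordinal nj).
have T1 : tnth w1 (Ordinal ni) = e.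
  by rewrite (tnth_nth e) E1 nth_cat ltnn subnn.
have T2 : tnth w1 (Ordinal nj) = f.
  by rewrite (tnth_nth e) E1 nth_cat /= ltnNge leqnSn /= subSnn.
rewrite eqxx T1 T2 Ief /=; apply/forallP => k; apply/eqP.
case: tpermP => [->|->|/eqP ki /eqP kj].
- by rewrite T2 (tnth_nth e) E2 nth_cat ltnn subnn.
- by rewrite T1 (tnth_nth e) E2 nth_cat /= ltnNge leqnSn /= subSnn.
rewrite !(tnth_nth e) E1 E2 !nth_cat; case: ltnP => // ik.
have {}ki : nat_of_ord k != size s.
  by apply: contraNneq ki => E; apply/eqP/val_inj.
have {}kj : nat_of_ord k != (size s).+1.
  by apply: contraNneq kj => E; apply/eqP/val_inj.
have lt : (size s).+1 < k by rewrite ltn_neqAle eq_sym kj ltn_neqAle eq_sym ki.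
by rewrite -(subnSK (ltnW lt)) -(subnSK lt).
Qed.

Lemma tr_tuple u v : tr u v -> forall n (w1 w2 : n.-tuple Sigma),
  val w1 = u -> val w2 = v -> trace_eq I w1 w2.
Proof.
elim=> [w|s e f t w Ief h IH] n w1 w2 E1 E2.
  by have -> : w1 = w2; [apply: val_inj; rewrite E1 E2|exact: connect0].
have sz : size (s ++ f :: e :: t) == n.
  by apply/eqP; rewrite -[RHS](size_tuple w1) -[tval w1]/(val w1) E1 !size_cat.
apply: connect_trans (IH n (Tuple sz) w2 erefl E2).
by apply: connect1; apply: (split_tswap Ief E1).
Qed.

Lemma trace_eqP n (w1 w2 : n.-tuple Sigma) :
  reflect (tr w1 w2) (trace_eq I w1 w2).
Proof.
apply: (iffP idP) => [/connectP[p]|h]; last exact: (tr_tuple h).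
elim: p w1 => [|w p IH] w1 /=; first by move=> _ ->; exact: tr_refl.
move=> /andP[/tswap_split[s [e [f [t [Ief -> E2]]]]] wp] lw.
by apply: tr_step => //; rewrite -E2; exact: IH.
Qed.

Lemma tswap_connect_sym n : connect_sym (@tswap Sigma I n).
Proof. by move=> u v; apply/trace_eqP/trace_eqP; apply: tr_sym. Qed.

(** One word per trace, the one chosen by [root] in its class of tuples. Traces can then be handled
    as the words fixed by [canon]. *)
Definition canon w : seq Sigma := val (fingraph.root (@tswap Sigma I (size w)) (in_tuple w)).

Lemma canon_tuple n (w : n.-tuple Sigma) : canon w = val (fingraph.root (@tswap Sigma I n) w).
Proof.
case: w => s Hs; have /eqP E := Hs; subst n; rewrite /canon /=.
by congr (val (fingraph.root _ _)); apply: val_inj.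
Qed.

Lemma tr_canon w : tr w (canon w).
Proof. exact: (@trace_eqP _ (in_tuple w) _ (connect_root _ _)). Qed.

Lemma canonP u v : reflect (tr u v) (canon u == canon v).
Proof.
apply: (iffP eqP) => [E|h].
  by apply: tr_trans (tr_canon u) _; rewrite E; apply/tr_sym/tr_canon.
have sz : size u == size v by rewrite (tr_size h).
rewrite -[u]/(val (Tuple sz)) -[v]/(val (in_tuple v)) !canon_tuple.
congr val; apply/eqP; rewrite root_connect; last exact: tswap_connect_sym.
exact/trace_eqP.
Qed.

Lemma canonK w : canon (canon w) = canon w.
Proof. by apply/eqP/canonP/tr_sym/tr_canon. Qed.

Lemma size_canon w : size (canon w) = size w.
Proof. by rewrite -(tr_size (tr_canon w)). Qed.

(** * Splitting a trace below and above the first occurrence of a letter *)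

Variable a : Sigma.

Definition above C e := (e == a) || [exists c in C, ~~ I c e].

(* [C] is the set of letters already known to lie above the first [a]. *)
Fixpoint low C w := if w is e :: w' then
  if above C e then low (e |: C) w' else e :: low C w' else [::].
Fixpoint high C w := if w is e :: w' then
  if above C e then e :: high (e |: C) w' else high C w' else [::].
Fixpoint reached C w := if w is e :: w' then
  if above C e then reached (e |: C) w' else reached C w' else C.

Lemma low_cat C u v : low C (u ++ v) = low C u ++ low (reached C u) v.
Proof. by elim: u C => //= e u IH C; case: ifP => _; rewrite IH. Qed.

Lemma high_cat C u v : high C (u ++ v) = high C u ++ high (reached C u) v.
Proof. by elim: u C => //= e u IH C; case: ifP => _; rewrite IH. Qed.

Lemma reached_cat C u v : reached C (u ++ v) = reached (reached C u) v.
Proof. by elim: u C => //= e u IH C; case: ifP => _; rewrite IH. Qed.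

Lemma above_indep C e f : I e f -> above (e |: C) f = above C f.
Proof.
move=> Ief; congr (_ || _); apply/existsP/existsP => -[c /andP[]].
  by rewrite !inE => /orP[/eqP->|cC nI]; [rewrite Ief|exists c; rewrite cC].
by move=> cC nI; exists c; rewrite !inE cC orbT.
Qed.

(** By [above_indep], swapping independent neighbours changes neither membership test, and they may
    enter [C] in either order; so each part undergoes at most one swap. *)
Lemma low_high_tr u v : tr u v -> forall C, tr (low C u) (low C v) /\ tr (high C u) (high C v).
Proof.
elim=> [w|s e f t w Ief _ IH] C; first by split; exact: tr_refl.
have Ife : I f e by rewrite I_sym.
have [] := IH C; rewrite !low_cat !high_cat /= !(above_indep _ Ief) !(above_indep _ Ife).
move=> hl hh; split; [apply: tr_trans hl|apply: tr_trans hh]; apply: tr_catl;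
  case: ifP => ae; case: ifP => af /=; rewrite ?ae ?af ?(setUCA [set e]);
  do ?[exact: tr_refl | by apply: (@tr_step [::]) Ief (tr_refl _)].
Qed.

Lemma low_indep C w : {in low C w, forall x, {in C, forall c, I c x}}.
Proof.
elim: w C => //= e w IH C x; case: ifP => ae.
  by move=> /IH h c cC; apply: h; rewrite !inE cC orbT.
rewrite inE => /orP[/eqP-> c cC|/IH //].
by apply/negPn/negP => nI; move/negbT: ae => /norP[_ /existsP[]]; exists c; rewrite cC.
Qed.

(** A letter put into [C] is independent of every later letter that stays low, so these can be moved
    in front of it. *)
Lemma tr_low_high C w : tr w (low C w ++ high C w).
Proof.
elim: w C => [|e w IH] C /=; first exact: tr_refl.
case: ifP => ae; last exact: (@tr_catl [:: e]).
apply: tr_trans (@tr_catl [:: e] _ _ (IH _)) _; apply/tr_sym/tr_move_front => x.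
by move=> /low_indep; apply; rewrite !inE eqxx.
Qed.

Lemma notin_low C w : a \notin low C w.
Proof.
elim: w C => //= e w IH C; case: ifP => // ae; rewrite inE negb_or IH andbT.
by apply: contraFneq ae => <-; rewrite /above eqxx.
Qed.

Lemma low_highK C w : low C (high C w) = [::].
Proof. by elim: w C => //= e w IH C; case: ifP => //= ae; rewrite ae IH. Qed.

Lemma high_highK C w : high C (high C w) = high C w.
Proof. by elim: w C => //= e w IH C; case: ifP => //= ae; rewrite ae IH. Qed.

Lemma reached_high C w : reached C (high C w) = reached C w.
Proof. by elim: w C => //= e w IH C; case: ifP => //= ae; rewrite ae IH. Qed.

Lemma split_notin u : a \notin u ->
  [/\ low set0 u = u, high set0 u = [::] & reached set0 u = set0].
Proof.
elim: u => //= e u IH; rewrite inE negb_or => /andP[ae /IH[-> -> ->]].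
have -> // : above set0 e = false.
rewrite /above eq_sym (negbTE ae); apply/existsP => -[c].
by rewrite inE.
Qed.

(** Every letter depends on itself, hence lies above the full alphabet. *)
Lemma split_setT u : low setT u = [::] /\ high setT u = u.
Proof.
elim: u => //= e u [IHl IHh].
have -> : above setT e by apply/orP; right; apply/existsP; exists e; rewrite inE I_irrefl.
by rewrite setUT IHl IHh.
Qed.

Lemma reached_sub C w : C \subset reached C w.
Proof.
elim: w C => //= e w IH C; case: ifP => _ //.
by apply: subset_trans (IH _); exact: subsetUr.
Qed.

Lemma reached_mem C w b : above C b -> b \in w -> b \in reached C w.
Proof.
elim: w C => //= e w IH C ab; rewrite inE => /orP[/eqP E|bw].
  by subst e; rewrite ab; apply: (subsetP (reached_sub _ _)); rewrite !inE eqxx.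
case: ifP => _; apply: IH => //.
case/orP: ab => [ab|/existsP[c /andP[cC nI]]]; apply/orP; [by left|right].
by apply/existsP; exists c; rewrite !inE cC orbT.
Qed.

(* If [y] lies entirely above its first [a] and meets every letter, then
   everything after [y] lies above that [a] too, so that the part before
   [y] is intrinsic to the trace. *)
Lemma split_unique p y x x' r r' :
  low set0 y = [::] -> high set0 y = y -> reached set0 y = setT ->
  a \notin p -> a \notin x -> a \notin x' ->
  tr (x ++ p ++ y ++ r) (x' ++ p ++ y ++ r') -> tr x x' /\ tr r r'.
Proof.
move=> ly hy ry ap ax ax'; rewrite !(catA _ p).
have split q s : a \notin q ->
    low set0 ((q ++ p) ++ y ++ s) = q ++ p /\ high set0 ((q ++ p) ++ y ++ s) = y ++ s.
  move=> aq; have [|l h e] := split_notin (u := q ++ p).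
    by rewrite mem_cat negb_or aq.
  rewrite (low_cat _ (q ++ p)) (high_cat _ (q ++ p)) l h e.
  rewrite low_cat high_cat ly hy ry.
  by have [-> ->] := split_setT s; rewrite !cats0.
move=> /low_high_tr /(_ set0); have [-> ->] := split _ r ax.
have [-> ->] := split _ r' ax'.
by move=> [/tr_cancel_r ? /tr_cancel_l].
Qed.

End TraceWords.

(** * Comparison of nonnegative sums over lists *)

Section SumInjection.
Import Order.TTheory GRing.Theory Num.Theory.
Local Open Scope ring_scope.

Lemma ler_sum_subset (R : numDomainType) (T : eqType) (s1 s2 : seq T) (g : T -> R) :
  (forall y, 0 <= g y) -> uniq s1 -> {subset s1 <= s2} ->
  \sum_(y <- s1) g y <= \sum_(y <- s2) g y.
Proof.
move=> g0; elim: s1 s2 => [|y s1 IH] s2 /=.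
  by move=> _ _; rewrite big_nil sumr_ge0.
move=> /andP[ys1 us1] sub; have ys2 : y \in s2 by apply: sub; rewrite mem_head.
rewrite (perm_big _ (perm_to_rem ys2)) !big_cons lerD2l; apply: IH => // x xs1.
have : x \in s2 by apply: sub; rewrite inE xs1 orbT.
rewrite (perm_mem (perm_to_rem ys2)) inE => /orP[/eqP xy|//].
by rewrite -xy xs1 in ys1.
Qed.

Lemma ler_sum_inj (R : numDomainType) (T1 T2 : eqType) (s1 : seq T1) (s2 : seq T2)
    (f : T1 -> T2) (g : T2 -> R) :
  (forall y, 0 <= g y) -> uniq s1 -> {in s1 &, injective f} ->
  (forall x, x \in s1 -> f x \in s2) ->
  \sum_(x <- s1) g (f x) <= \sum_(y <- s2) g y.
Proof.
move=> g0 us1 fI fs; rewrite -(big_map f xpredT); apply: ler_sum_subset => //.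
  by rewrite map_inj_in_uniq.
by move=> _ /mapP[x xs ->]; exact: fs.
Qed.

End SumInjection.

(** * Weighted counting of executions *)

Section Executions.
Set Implicit Arguments.
Unset Strict Implicit.
Local Notation act := Defs.act.
Variables (Sigma : finType) (I : rel Sigma).
Hypotheses (I_irrefl : irreflexive I) (I_sym : symmetric I).
Variables (X : finType) (d : Sigma -> option X -> option X).
Hypothesis d_bot : forall a : Sigma, d a None = None.
Hypothesis d_comm : forall a b : Sigma, I a b -> forall s, d b (d a s) = d a (d b s).
Implicit Types (u v w : seq Sigma) (P : pred Sigma) (al be ga de : X).

Lemma act_cat s u v : act d s (u ++ v) = act d (act d s u) v.
Proof. exact: foldl_cat. Qed.

Lemma act_None w : act d None w = None.
Proof. by elim: w => //= a w; rewrite d_bot. Qed.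

Lemma act_cat_Some s u v be : act d s (u ++ v) = Some be ->
  exists2 ga, act d s u = Some ga & act d (Some ga) v = Some be.
Proof.
rewrite act_cat; case: (act d s u) => [ga|]; last by rewrite act_None.
by exists ga.
Qed.

Lemma act_tr u v : tr I u v -> forall s, act d s u = act d s v.
Proof.
elim=> // s e f t w Ief _ IH st; rewrite -IH !act_cat /=.
by rewrite d_comm.
Qed.

(** Canonical words stand for traces, so that sums over traces become sums over duplicate-free lists
    of words. *)
Definition execs P al be n : seq (seq Sigma) :=
  [seq tval t | t <- enum [set t : n.-tuple Sigma |
     [&& all P t, act d (Some al) t == Some be & canon I t == t]]].

Lemma mem_execs P al be n v : (v \in execs P al be n) =
  [&& size v == n, all P v, act d (Some al) v == Some be & canon I v == v].
Proof.
apply/mapP/idP => [[w]|/andP[sz h]].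
  by rewrite mem_enum inE => h ->; rewrite size_tuple eqxx.
by exists (Tuple sz); rewrite // mem_enum inE.
Qed.

Lemma uniq_execs P al be n : uniq (execs P al be n).
Proof. by rewrite map_inj_uniq ?enum_uniq //; exact: val_inj. Qed.

(** Swaps preserve the letters and the action, so each class counted by [ntraces] contains exactly
    one canonical word. *)
Lemma size_execs P al be n : size (execs P al be n) = ntraces I d P al be n.
Proof.
rewrite size_map -cardE /ntraces /equivalence_partition.
set N := [set w | _]; set D := [set w | _].
pose f (x : n.-tuple Sigma) := [set y in D | trace_eq I x y].
have sND : {subset N <= D} by move=> w; rewrite !inE => /and3P[-> ->].
have -> : [set [set y in D | trace_eq I x y] | x in D] = f @: N.
  apply/setP => A; apply/imsetP/imsetP => -[x xD ->]; last by exists x; rewrite ?sND.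
  exists (fingraph.root (@tswap Sigma I n) x).
    have h : tr I x (fingraph.root (@tswap Sigma I n) x).
      by apply/trace_eqP => //; exact: connect_root.
    move: xD; rewrite !inE -(act_tr h) -(eq_all_r (perm_mem (tr_perm h))).
    case/andP=> -> ->; rewrite canon_tuple /=; apply/eqP; congr val.
    exact: (fingraph.root_root (tswap_connect_sym I_sym (n:=n))).
  apply/setP => y; rewrite !inE; congr (_ && _).
  by apply: (same_connect (tswap_connect_sym I_sym (n:=n))); exact: connect_root.
rewrite card_in_imset // => x y xN yN /setP/(_ y).
have ty : trace_eq I y y by exact: connect0.
have fE t : (y \in f t) = trace_eq I t y by rewrite in_set (sND _ yN).
rewrite !fE ty => /trace_eqP h.
move: xN yN; rewrite !inE => /and3P[_ _ /eqP xE] /and3P[_ _ /eqP yE].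
by apply: val_inj; rewrite /= -xE -yE; apply/eqP/canonP => //; exact: h.
Qed.

Fixpoint execs_lt P al be N : seq (seq Sigma) :=
  if N is n.+1 then execs_lt P al be n ++ execs P al be n else [::].

Lemma mem_execs_lt P al be N v : (v \in execs_lt P al be N) =
  [&& size v < N, all P v, act d (Some al) v == Some be & canon I v == v].
Proof.
elim: N => [|N IH]; first by rewrite in_nil ltn0.
by rewrite mem_cat IH mem_execs -andb_orl [in RHS]ltnS [in RHS]leq_eqVlt orbC.
Qed.

Lemma uniq_execs_lt P al be N : uniq (execs_lt P al be N).
Proof.
elim: N => //= N IH; rewrite cat_uniq IH uniq_execs andbT /=.
apply/hasPn => v; rewrite mem_execs mem_execs_lt => /andP[/eqP-> _].
by rewrite ltnn.
Qed.

Lemma canon_mem_execs_lt P al be N v : (size v < N)%N -> all P v ->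
  act d (Some al) v = Some be -> canon I v \in execs_lt P al be N.
Proof.
move=> sz Pv av; have h := tr_canon I v.
rewrite mem_execs_lt size_canon // sz canonK // eqxx -(act_tr h) av eqxx !andbT /=.
by rewrite -(eq_all_r (perm_mem (tr_perm h))).
Qed.

Lemma canon_mem_execs P al be v : all P v ->
  act d (Some al) v = Some be -> canon I v \in execs P al be (size v).
Proof.
move=> Pv av; have h := tr_canon I v.
rewrite mem_execs size_canon // eqxx canonK // eqxx -(act_tr h) av eqxx !andbT /=.
by rewrite -(eq_all_r (perm_mem (tr_perm h))).
Qed.

(** * Executions that bring every letter above the first [a] *)

(** A path of dependent letters from [a] to a letter outside [C] has an edge leaving [C]. *)
Lemma exit_dependent (C : {set Sigma}) a : irreducible_monoid I ->
  a \in C -> C != [set: Sigma] ->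
  exists c b, [/\ c \in C, b \notin C & ~~ I c b].
Proof.
move=> irr aC; rewrite eqEsubset subsetT /= => /subsetPn[b _ bC].
have /connectP[q] := irr a b; elim: q a aC => [|x q IH] a aC /=.
  by move=> _ E; rewrite E aC in bC.
move=> /andP[Iax qx] E; have [xC|xC] := boolP (x \in C); first exact: (IH x).
by exists a, x.
Qed.

(** Aliveness supplies an execution containing a letter outside [C] that depends on [C]; running it
    enlarges [C] strictly, and the process is repeated from the state reached. *)
Lemma reach_all_letters a : alive d -> irreducible_monoid I ->
  forall al (C : {set Sigma}), a \in C ->
  exists w be, act d (Some al) w = Some be /\ reached I a C w = [set: Sigma].
Proof.
move=> liv irr al C; have [n] := ubnP #|~: C|.
elim: n al C => // n IH al C leC aC.
have [->|CT] := eqVneq C [set: Sigma]; first by exists [::], al.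
have [c [b [cC bC nI]]] := exit_dependent irr aC CT.
have [w [bw]] := liv al b; case aw : (act d (Some al) w) => [be|] // _.
have bR : b \in reached I a C w.
  by apply: reached_mem bw; apply/orP; right; apply/existsP; exists c; rewrite cC.
have sub := reached_sub I a C w.
have [||w' [be' [aw' rw']]] := IH be (reached I a C w).
- rewrite ltnS in leC; apply: leq_trans leC; apply: proper_card; apply/properP.
  by rewrite setCS; split=> //; exists b; rewrite !inE ?bR.
- exact: (subsetP sub).
- by exists (w ++ w'), be'; rewrite act_cat aw reached_cat.
Qed.

(** An execution [u] containing [a], continued by [v] until every letter has been reached, is split
    into its low part [p] and its high part [y]; accessibility provides the return [z]. *)
Lemma exists_synchronizing_loop a ga de :
  accessible d -> alive d -> irreducible_monoid I ->
  exists p y z, [/\ a \notin p, low I a set0 y = [::], high I a set0 y = y,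
    reached I a set0 y = [set: Sigma] & act d (Some de) (p ++ y ++ z) = Some ga].
Proof.
move=> acc liv irr.
have [u [au]] := liv de a; case du : (act d (Some de) u) => [be|] // _.
have ar : a \in reached I a set0 u by apply: reached_mem au; rewrite /above eqxx.
have [v [be' [dv rv]]] := reach_all_letters liv irr be ar.
have [z dz] := acc be' ga.
exists (low I a set0 (u ++ v)), (high I a set0 (u ++ v)), z; split.
- exact: notin_low.
- exact: low_highK.
- exact: high_highK.
- by rewrite reached_high reached_cat.
rewrite catA act_cat -(act_tr (tr_low_high I_sym a set0 (u ++ v))).
by rewrite act_cat du dv.
Qed.

(** * Terms and partial sums of the generating functions at [rho] *)

Section Weights.
Import Order.TTheory GRing.Theory Num.Theory.
Local Open Scope ring_scope.
Variables (R : numDomainType) (rho : R).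
Hypothesis rho_ge0 : 0 <= rho.

Definition wcount P al be n : R := (ntraces I d P al be n)%:R * rho ^+ n.

Definition wsum P al be N : R := \sum_(n < N) wcount P al be n.

Lemma wcount_ge0 P al be n : 0 <= wcount P al be n.
Proof. by rewrite mulr_ge0 ?exprn_ge0. Qed.

Lemma wsum_ge0 P al be N : 0 <= wsum P al be N.
Proof. by apply: sumr_ge0 => n _; exact: wcount_ge0. Qed.

Lemma wcountE P al be n : wcount P al be n = \sum_(w <- execs P al be n) rho ^+ size w.
Proof.
rewrite big_seq (eq_bigr (fun=> rho ^+ n)) => [|w]; last first.
  by rewrite mem_execs => /andP[/eqP->].
rewrite -big_seq /wcount -size_execs mulr_natl.
by rewrite big_const_seq count_predT iter_addr_0.
Qed.

Lemma wsumE P al be N : wsum P al be N = \sum_(w <- execs_lt P al be N) rho ^+ size w.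
Proof.
rewrite /wsum; elim: N => [|N IH]; first by rewrite big_ord0 big_nil.
by rewrite big_ord_recr /= big_cat /= IH wcountE.
Qed.

(** The canonical factors of [w] determine its trace, and weights are multiplicative; so the sum
    embeds into a double sum split according to [ga]. *)
Lemma wsum_factor (s : seq (seq Sigma)) (A B : X -> seq (seq Sigma))
    (f g : seq Sigma -> seq Sigma) :
  uniq s -> (forall w, w \in s -> [/\ canon I w = w, tr I w (f w ++ g w) &
    exists ga, canon I (f w) \in A ga /\ canon I (g w) \in B ga]) ->
  \sum_(w <- s) rho ^+ size w <=
  \sum_ga (\sum_(x <- A ga) rho ^+ size x) * (\sum_(y <- B ga) rho ^+ size y).
Proof.
move=> us h.
pose pairs := [seq q | ga <- index_enum X, q <- [seq (x, y) | x <- A ga, y <- B ga]].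
pose W (q : seq Sigma * seq Sigma) := rho ^+ size q.1 * rho ^+ size q.2.
apply: (@le_trans _ _ (\sum_(q <- pairs) W q)).
  rewrite big_seq (eq_bigr (fun w => W (canon I (f w), canon I (g w)))) => [|w ws]; last first.
    have [_ /tr_size E _] := h _ ws.
    by rewrite /W /= !size_canon // E size_cat exprD.
  rewrite -big_seq; apply: ler_sum_inj => //.
  - by move=> q; rewrite mulr_ge0 ?exprn_ge0.
  - move=> w w' /h[Ew tw _] /h[Ew' tw' _] [/eqP/(canonP I_sym) t1 /eqP/(canonP I_sym) t2].
    rewrite -Ew -Ew'; apply/eqP/canonP => //.
    exact: tr_trans tw (tr_trans (tr_cat t1 t2) (tr_sym I_sym tw')).
  - move=> w /h[_ _ [ga [hA hB]]]; apply/allpairsPdep.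
    exists ga, (canon I (f w), canon I (g w)).
    by rewrite mem_index_enum; split=> //; apply: allpairs_f.
rewrite big_allpairs_dep; apply: ler_sum => ga _.
rewrite big_allpairs_dep mulr_suml; apply: ler_sum => x _.
by rewrite mulr_sumr.
Qed.

Lemma wcount_submul P al be m n :
  wcount P al be (m + n)%N <= \sum_ga wcount P al ga m * wcount P ga be n.
Proof.
rewrite wcountE; under [leRHS]eq_bigr => ga _ do rewrite !wcountE.
apply: (wsum_factor (f := take m) (g := drop m)) => [|w]; first exact: uniq_execs.
rewrite mem_execs => /and4P[/eqP sz Pw /eqP aw /eqP cw]; split=> //.
  by rewrite cat_take_drop; exact: tr_refl.
move: Pw aw; rewrite -{1 2}(cat_take_drop m w) all_cat => /andP[P1 P2].
have s1 : size (take m w) = m by rewrite size_take sz; case: ltngtP (leq_addr n m).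
have s2 : size (drop m w) = n by rewrite size_drop sz addKn.
case/act_cat_Some => ga a1 a2; exists ga.
by have := canon_mem_execs P1 a1; have := canon_mem_execs P2 a2; rewrite s1 s2.
Qed.

(** Letters of [A] commute with the others, so an execution is rearranged into its [A]-part followed
    by the rest, each no longer than the whole. *)
Lemma wsum_indep_factor (A : pred Sigma) (P1 P2 : pred Sigma) al be N :
  (forall x y, A x -> ~~ A y -> I x y) ->
  (forall x, A x -> P1 x) -> (forall x, ~~ A x -> P2 x) ->
  wsum predT al be N <= \sum_ga wsum P1 al ga N * wsum P2 ga be N.
Proof.
move=> IA AP1 AP2; rewrite wsumE; under [leRHS]eq_bigr => ga _ do rewrite !wsumE.
apply: (wsum_factor (f := filter A) (g := filter (predC A))) => [|w].
  exact: uniq_execs_lt.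
rewrite mem_execs_lt => /and4P[sz _ /eqP aw /eqP cw].
have h := tr_filter_split I_sym w IA; split=> //.
move: aw; rewrite (act_tr h) => /act_cat_Some[ga a1 a2]; exists ga.
split; apply: canon_mem_execs_lt => //.
- by apply: leq_ltn_trans sz; rewrite size_filter count_size.
- by apply: sub_all (filter_all A w) => x; exact: AP1.
- by apply: leq_ltn_trans sz; rewrite size_filter count_size.
- by apply: sub_all (filter_all (predC A) w) => x; exact: AP2.
Qed.

Section Renewal.
(* By [split_unique], an [a]-free execution [x] from [ga] to [de] and a loop [r]
   at [ga] can both be read off the trace of [x ++ p ++ y ++ z ++ r]. *)
Variables (a : Sigma) (ga de : X) (p y z : seq Sigma).
Hypotheses (ap : a \notin p) (ly : low I a set0 y = [::])
  (hy : high I a set0 y = y) (ry : reached I a set0 y = setT).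
Hypothesis loop : act d (Some de) (p ++ y ++ z) = Some ga.

Lemma wsum_renewal K N :
  1 + rho ^+ size (p ++ y ++ z) * wsum (fun b => b != a) ga de K * wsum predT ga ga N
  <= wsum predT ga ga (size (p ++ y ++ z) + K + N).
Proof.
set L := size _.
(* The word [y] reaches all letters from the empty set, hence is nonempty; this keeps the empty loop
   apart from the loops encoded by [f]. *)
have L_gt0 : (0 < L)%N.
  rewrite /L !size_cat; case: y ry => [/setP/(_ a)|? ?]; rewrite ?inE //.
  by rewrite !addSn addnS.
pose f (q : seq Sigma * seq Sigma) := canon I (q.1 ++ p ++ y ++ z ++ q.2).
pose S := [seq (x, r) | x <- execs_lt (fun b => b != a) ga de K, r <- execs_lt predT ga ga N].
have szf x r : size (f (x, r)) = (L + size x + size r)%N.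
  rewrite size_canon /=; have -> : x ++ p ++ y ++ z ++ r = x ++ (p ++ y ++ z) ++ r.
    by rewrite -!catA.
  by rewrite !(size_cat x) size_cat addnCA addnA.
have -> : rho ^+ L * wsum (fun b => b != a) ga de K * wsum predT ga ga N =
    \sum_(q <- S) rho ^+ size (f q).
  rewrite !wsumE big_allpairs_dep -mulrA mulr_suml mulr_sumr; apply: eq_bigr => x _.
  rewrite mulr_sumr mulr_sumr; apply: eq_bigr => r _.
  by rewrite szf !exprD mulrA.
rewrite wsumE -(big_map f xpredT (fun w => rho ^+ size w)).
(* The summand 1 is the weight of the empty loop, adjoined to the encoded words. *)
have -> : 1 = rho ^+ size (Nil Sigma) by [].
rewrite -(big_cons _ _ [::] _ xpredT (fun w : seq Sigma => rho ^+ size w)).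
apply: ler_sum_subset => [w||w]; first by rewrite exprn_ge0.
- rewrite cons_uniq; apply/andP; split.
    apply/mapP => -[[x r] _ /(congr1 size)]; rewrite szf /= => /esym/eqP.
    by rewrite !addn_eq0 gtn_eqF.
  rewrite map_inj_in_uniq; first rewrite allpairs_uniq ?uniq_execs_lt //.
    by move=> [? ?] [? ?] _ _ [-> ->].
  move=> _ _ /allpairsP[[x r] [xK rN ->]] /allpairsP[[x' r'] [xK' rN' ->]].
  move: xK rN xK' rN'; rewrite !mem_execs_lt /=.
  move=> /and4P[_ ax _ /eqP cx] /and4P[_ _ _ /eqP cr].
  move=> /and4P[_ ax' _ /eqP cx'] /and4P[_ _ _ /eqP cr'] /eqP/(canonP I_sym) /= h.
  have nota w : all (fun b => b != a) w -> a \notin w.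
    by move=> /allP aw; apply/negP => /aw; rewrite eqxx.
  have [tx] := split_unique I_irrefl I_sym ly hy ry ap (nota _ ax) (nota _ ax') h.
  move/(tr_cancel_l I_irrefl I_sym) => tz.
  by rewrite -cx -cx' -cr -cr'; congr (_, _); apply/eqP/canonP.
- rewrite inE => /orP[/eqP->|/mapP[_ /allpairsP[[x r] [xK rN ->]] ->]].
    rewrite mem_execs_lt /= !addn_gt0 L_gt0 /= eqxx /=.
    by apply/eqP/size0nil; rewrite size_canon.
  move: xK rN; rewrite !mem_execs_lt szf /=.
  move=> /and4P[sx _ /eqP ax _] /and4P[sr _ /eqP ar _].
  rewrite canonK // eqxx andbT -(act_tr (tr_canon I _)) !catA act_cat.
  rewrite -!catA act_cat ax loop ar eqxx andbT all_predT andbT.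
  by rewrite -!addnA ltn_add2l -addnS leq_add // ltnW.
Qed.

End Renewal.
End Weights.
End Executions.

From mathcomp Require Import all_classical all_reals all_analysis.
From mathcomp Require Import ring.

(** * Characteristic roots *)

Section Radius.
Set Implicit Arguments.
Unset Strict Implicit.
Import Order.TTheory GRing.Theory Num.Theory.
Import numFieldNormedType.Exports.
Local Open Scope classical_set_scope.
Local Open Scope ring_scope.
Variable R : realType.
Implicit Types (c : nat -> nat) (rho : R).

Lemma series_nat_nondecreasing c rho : 0 <= rho ->
  nondecreasing_seq (series (fun n => (c n)%:R * rho ^+ n)).
Proof.
move=> r0; apply: nondecreasing_series => n _ _.
by rewrite mulr_ge0 ?exprn_ge0.
Qed.

Lemma le_radius c rho C : 0 <= rho ->
  (forall N, \sum_(n < N) (c n)%:R * rho ^+ n <= C) -> (rho%:E <= Defs.radius R c)%E.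
Proof.
move=> r0 hC; apply: ereal_sup_ubound; exists rho => //; split=> //.
apply: nondecreasing_is_cvgn; first exact: series_nat_nondecreasing.
by exists C => _ [N _ <-]; rewrite /series /= big_mkord.
Qed.

Lemma lt_radius c rho : 0 <= rho -> (rho%:E < Defs.radius R c)%E ->
  exists C, forall N, \sum_(n < N) (c n)%:R * rho ^+ n <= C.
Proof.
move=> r0 /ereal_sup_gt[_ [rho' [r0' cv] <-]]; rewrite lte_fin => rr.
exists (limn (series (fun n => (c n)%:R * rho' ^+ n))) => N.
apply: (@le_trans _ _ (series (fun n => (c n)%:R * rho' ^+ n) N)); last first.
  by apply: nondecreasing_cvgn_le => //; exact: series_nat_nondecreasing.
rewrite /series /= big_mkord; apply: ler_sum => n _.
by rewrite ler_wpM2l // lerXn2r // ?nnegrE // ltW.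
Qed.

Lemma exists_nth_root n (x : R) : (0 < n)%N -> 0 <= x -> exists2 q, 0 <= q & q ^+ n = x.
Proof.
move=> n0 x0; exists (x `^ (n%:R^-1)); first exact: powR_ge0.
by rewrite -powR_mulrn ?powR_ge0 // -powRrM mulVf ?powRr1 // pnatr_eq0 -lt0n.
Qed.

Variables (Sigma : finType) (I : rel Sigma).
Variables (X : finType) (d : Sigma -> option X -> option X).
Implicit Types (P : pred Sigma).

(** Together with [lt_char_root], this turns comparisons with the characteristic root into uniform
    bounds on partial sums, the terms being nonnegative. *)
Lemma le_char_root P rho C : 0 <= rho ->
  (forall al be N, wsum I d rho P al be N <= C) ->
  (rho%:E <= char_root R I d P)%E.
Proof.
move=> r0 hC; apply: le_bigmin; first exact: leey.
by move=> p _; exact: le_radius r0 (hC p.1 p.2).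
Qed.

Lemma lt_char_root P rho : 0 <= rho -> (rho%:E < char_root R I d P)%E ->
  exists2 C, 0 <= C & forall al be N, wsum I d rho P al be N <= C.
Proof.
move=> r0 /bigmin_gtP[_ h].
have {}h (p : X * X) : exists C, forall N, wsum I d rho P p.1 p.2 N <= C.
  by apply: lt_radius => //; exact: h.
have [C hC] := choice h; exists (\sum_p `|C p|).
  by apply: sumr_ge0 => p _; exact: normr_ge0.
move=> al be N; apply: le_trans (hC (al, be) N) _.
rewrite (bigD1 (al, be)) //=; apply: le_trans (ler_norm _) _.
by rewrite lerDl; apply: sumr_ge0 => p _.
Qed.

(** At 0 only the term of length 0 survives, so the partial sums are bounded. *)
Lemma char_root_ge0 P : (0 <= char_root R I d P)%E.
Proof.
apply: (@le_char_root P 0 (\sum_(p : X * X) (ntraces I d P p.1 p.2 0)%:R)) => //.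
move=> al be N; rewrite /wsum.
rewrite (bigD1 (al, be)) //=; apply: (@le_trans _ _ (ntraces I d P al be 0)%:R).
  case: N => [|N]; first by rewrite big_ord0.
  rewrite big_ord_recl /= /wcount expr0 mulr1 big1 ?addr0 // => n _.
  by rewrite expr0n mulr0.
by rewrite lerDl; apply: sumr_ge0.
Qed.

Lemma exists_between_ereal (x y : \bar R) : (0 <= x)%E -> (x < y)%E ->
  exists rho : R, [/\ 0 <= rho, (x < rho%:E)%E & (rho%:E < y)%E].
Proof.
case: x => [x| |]; last 2 first.
- by move=> _; rewrite ltNge leey.
- by rewrite leeNy_eq.
rewrite lee_fin => x0.
case: y => [y| |]; last 2 first.
- by move=> _; exists (x + 1); rewrite ltry lte_fin ltrDl ltr01 addr_ge0.
- by rewrite ltNge leNye.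
rewrite lte_fin => xy; have [xm my] := midf_lt xy.
by exists ((x + y) / 2); rewrite !lte_fin (le_trans x0) ?ltW.
Qed.

(** Splitting off the first [n] terms bounds the sum up to [N] by [U] plus [u n] times the sum up to
    [N - n]; the bound claimed is the fixed point of this recursion. *)
Lemma sum_submul_bounded (u : nat -> R) n : (forall m, 0 <= u m) ->
  (forall m k, u (m + k)%N <= u m * u k) -> (0 < n)%N -> u n < 1 ->
  forall N, \sum_(i < N) u i <= (\sum_(i < n) u i) / (1 - u n).
Proof.
move=> u0 usub n0 un1 N; set U := \sum_(i < n) _.
have D0 : 0 < 1 - u n by rewrite subr_gt0.
have U0 : 0 <= U by apply: sumr_ge0.
have UD : U <= U / (1 - u n) by rewrite ler_pdivlMr // ler_piMr // lerBlDr lerDl.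
have [k] := ubnP N; elim: k N => // k IH N; rewrite ltnS => Nk.
have [Nn|nN] := leqP N n.
  apply: le_trans UD; rewrite /U -(subnKC Nn) big_split_ord /= lerDl.
  by apply: sumr_ge0.
rewrite -(subnKC (ltnW nN)) big_split_ord /= -/U.
apply: (@le_trans _ _ (U + u n * (U / (1 - u n)))).
  rewrite lerD2l; apply: (@le_trans _ _ (u n * \sum_(i < N - n) u i)).
    by rewrite mulr_sumr; apply: ler_sum => i _; exact: usub.
  rewrite ler_wpM2l // IH //; apply: leq_trans Nk.
  by rewrite -subn_gt0 subKn // ltnW.
by rewrite le_eqVlt; apply/orP; left; apply/eqP; field; rewrite gt_eqF.
Qed.

(** * Total weights at the characteristic root *)

Hypotheses (I_irrefl : irreflexive I) (I_sym : symmetric I).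
Hypothesis d_bot : forall a : Sigma, d a None = None.
Hypothesis d_comm : forall a b : Sigma, I a b -> forall s, d b (d a s) = d a (d b s).

Definition total_wcount rho P n : R :=
  \sum_(p : X * X) wcount I d rho P p.1 p.2 n.

(** [wcount_submul] is an inequality between matrices; once all entries are summed, the two factors
    need no longer share the intermediate state, every term being nonnegative. *)
Lemma total_wcount_submul rho P m n : 0 <= rho ->
  total_wcount rho P (m + n)%N <= total_wcount rho P m * total_wcount rho P n.
Proof.
move=> r0; have E k : total_wcount rho P k = \sum_al \sum_be wcount I d rho P al be k.
  by rewrite pair_bigA.
rewrite (E (m + n)%N) (E m) mulr_suml; apply: ler_sum => al _.
apply: (@le_trans _ _ (\sum_be \sum_ga wcount I d rho P al ga m * wcount I d rho P ga be n)).
  by apply: ler_sum => be _; exact: wcount_submul.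
rewrite exchange_big mulr_suml; apply: ler_sum => ga _ /=.
rewrite -mulr_sumr ler_wpM2l ?wcount_ge0 // E [leRHS](bigD1 ga) //= lerDl.
by apply: sumr_ge0 => al' _; apply: sumr_ge0 => be' _; exact: wcount_ge0.
Qed.

(* Otherwise submultiplicativity of the total weights makes the series converge
   beyond the characteristic root. *)
Lemma char_root_critical P rho n : (0 < n)%N -> 0 <= rho ->
  char_root R I d P = rho%:E -> 1 <= total_wcount rho P n.
Proof.
move=> n0 r0 rE; rewrite leNgt; apply/negP => lt1.
pose T : R := \sum_(p : X * X) (ntraces I d P p.1 p.2 n)%:R.
have TE x : total_wcount x P n = T * x ^+ n by rewrite /T mulr_suml.
have T0 : 0 <= T by apply: sumr_ge0.
have T1 : 0 < T + 1 by rewrite ltr_wpDl.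
(* The denominator [T + 1] is positive even if [T] vanishes, and makes [T * e] smaller than the gap
   [1 - T * rho ^+ n]; so the total weight stays below 1 at [rho']. *)
rewrite TE in lt1; set e := (1 - T * rho ^+ n) / (T + 1).
have e0 : 0 < e by rewrite divr_gt0 // subr_gt0.
have [|rho' r0' r'E] := @exists_nth_root n (rho ^+ n + e) n0.
  by rewrite addr_ge0 ?exprn_ge0 // ltW.
have rr : rho < rho'.
  rewrite ltNge; apply/negP => le_r; have : rho' ^+ n <= rho ^+ n.
    by rewrite lerXn2r.
  by rewrite r'E gerDl leNgt e0.
have t1 : total_wcount rho' P n < 1.
  rewrite TE r'E mulrDr -ltrBrDl /e mulrCA mulrC gtr_pMl ?subr_gt0 //.
  by rewrite ltr_pdivrMr // mul1r ltrDl.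
suff : (rho'%:E <= char_root R I d P)%E by rewrite rE lee_fin leNgt rr.
apply: le_char_root => // al be N.
have tg m : 0 <= total_wcount rho' P m by apply: sumr_ge0 => p _; exact: wcount_ge0.
apply: le_trans (sum_submul_bounded tg _ n0 t1 N) => [|m k]; last exact: total_wcount_submul.
rewrite /wsum; apply: ler_sum => i _; rewrite /total_wcount (bigD1 (al, be)) //= lerDl.
by apply: sumr_ge0 => p _; exact: wcount_ge0.
Qed.

(** Each positive length contributes at least 1 to the total, so the partial sums added over all
    pairs of states are unbounded; the pairs being finitely many, one of them is responsible. *)
Lemma exists_unbounded_wsum P rho : 0 <= rho -> char_root R I d P = rho%:E ->
  exists p : X * X, forall C : R, exists K, C < wsum I d rho P p.1 p.2 K.
Proof.
move=> r0 rE; apply: contrapT => nex.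
have h (p : X * X) : exists C, forall K, wsum I d rho P p.1 p.2 K <= C.
  apply: contrapT => nC; apply: nex; exists p => C; apply: contrapT => nK.
  by apply: nC; exists C => K; rewrite leNgt; apply/negP => lt; apply: nK; exists K.
have [C hC] := choice h.
pose K := (Num.truncn (\sum_p C p)).+1.
have : \sum_p wsum I d rho P p.1 p.2 K.+1 <= \sum_p C p by apply: ler_sum.
rewrite leNgt => /negP; apply.
(* Length 0 is set aside because [char_root_critical] concerns positive lengths; the remaining [K]
   lengths already exceed the sum of the bounds. *)
rewrite exchange_big /= big_ord_recl /=.
apply: (@lt_le_trans _ _ K%:R); first exact: truncnS_gt.
rewrite -[K%:R]add0r lerD //.
  by apply: sumr_ge0 => p _; exact: wcount_ge0.
rewrite -[K in K%:R]card_ord -sumr_const; apply: ler_sum => i _.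
exact: (char_root_critical _ r0 rE).
Qed.

(** * Irreducible systems have the spectral property *)

Section Loop.
Variables (a : Sigma) (ga de : X) (p y z : seq Sigma).
Hypotheses (ap : a \notin p) (ly : low I a finset.set0 y = [::])
  (hy : high I a finset.set0 y = y) (ry : reached I a finset.set0 y = finset.setTfor Sigma).
Hypothesis loop : Defs.act d (Some de) (p ++ y ++ z) = Some ga.

(** With a factor at least 1, each use of [wsum_renewal] adds 1 to the sum over loops at [ga], while
    below the characteristic root these sums are bounded. *)
Lemma char_root_le_renewal rho K : 0 <= rho ->
  1 <= rho ^+ size (p ++ y ++ z) * wsum I d rho (fun b => b != a) ga de K ->
  (char_root R I d predT <= rho%:E)%E.
Proof.
move=> r0 w1; rewrite leNgt; apply/negP => /(lt_char_root r0)[C C0 hC].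
set M := (size (p ++ y ++ z) + K)%N.
have h k : k%:R <= wsum I d rho predT ga ga (k * M).
  elim: k => [|k IH]; first exact: wsum_ge0.
  rewrite mulSn.
  apply: le_trans _ (wsum_renewal I_irrefl I_sym d_comm r0 ap ly hy ry loop K _).
  rewrite -natr1 addrC lerD2l; apply: le_trans IH _.
  by rewrite ler_peMl // wsum_ge0.
have := truncnS_gt C; apply/negP; rewrite -leNgt.
exact: le_trans (h _) (hC _ _ _).
Qed.

End Loop.

(** At a finite $r^a$ the sums over [a]-free executions are unbounded, so the renewal condition
    holds there with room to spare and survives a slight decrease of the argument. *)
Lemma irreducible_char_root_lt a : (0 < #|X|)%N -> irreducible_system I d ->
  (char_root R I d predT < char_root R I d (fun b => b != a))%E.
Proof.
move=> /card_gt0P[ga0 _] [acc liv irr].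
have := char_root_ge0 (fun b => b != a).
case rE : (char_root R I d (fun b => b != a)) => [rho| |]; last by rewrite leeNy_eq.
  rewrite lee_fin => r0; have [[ga de] /= unb] := exists_unbounded_wsum r0 rE.
  have rp : 0 < rho.
    (* At 0 the total weight of length 1 would vanish, against [char_root_critical]. *)
    rewrite lt0r r0 andbT; apply/eqP => rho0.
    have := char_root_critical (ltn0Sn 0) r0 rE; rewrite /total_wcount big1 ?ler10 // => p _.
    by rewrite /wcount rho0 expr1 mulr0.
  have [p [y [z [ap ly hy ry loop]]]] :=
    exists_synchronizing_loop I_sym d_comm a ga de acc liv irr.
  set L := size (p ++ y ++ z); have [K hK] := unb (2 / rho ^+ L).
  (* The choice of [K] makes the renewal factor exceed 2 at [rho]. All powers of [rho] in it have
     exponent below [(L + K).+1], so passing to [q * rho] at most halves it. *)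
  have [|q q0 qE] := @exists_nth_root (L + K).+1 (2^-1) (ltn0Sn _).
    by rewrite invr_ge0.
  have q1 : q < 1.
    rewrite ltNge; apply/negP => q1; have := exprn_ege1 (L + K).+1 q1.
    by rewrite qE invf_ge1 // lern1.
  apply: (@le_lt_trans _ _ (q * rho)%:E); last by rewrite lte_fin gtr_pMl.
  have qr0 : 0 <= q * rho by rewrite mulr_ge0.
  apply: (char_root_le_renewal ap ly hy ry loop (K := K) qr0).
  apply: (@le_trans _ _ (2^-1 * (rho ^+ L * wsum I d rho (fun b => b != a) ga de K))).
    rewrite ltr_pdivrMr ?exprn_gt0 // mulrC in hK.
    by rewrite mulrC ler_pdivlMr // mul1r ltW.
  rewrite -qE /wsum !mulr_sumr; apply: ler_sum => n _; rewrite /wcount.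
  rewrite [leRHS](_ : _ = q ^+ (L + n) *
    (rho ^+ L * ((ntraces I d (fun b => b != a) ga de n)%:R * rho ^+ n))); last first.
    by rewrite !exprMn exprD; ring.
  rewrite ler_wpM2r ?mulr_ge0 ?exprn_ge0 // ler_wiXn2l // ?ltW //.
  by rewrite leqW // leq_add2l ltnW.
(* For an infinite $r^a$ the value 1 suffices: the empty execution from [ga0] to itself already
   makes the factor at least 1. *)
move=> _; apply: (@le_lt_trans _ _ 1%:E); last exact: ltry.
have [p [y [z [ap ly hy ry loop]]]] :=
    exists_synchronizing_loop I_sym d_comm a ga0 ga0 acc liv irr.
apply: (char_root_le_renewal ap ly hy ry loop (K := 1)) => //.
rewrite expr1n mul1r /wsum big_ord1 /wcount expr0 mulr1 ler1n -size_execs //.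
have : [::] \in execs I d (fun b => b != a) ga0 ga0 0.
  by rewrite mem_execs /= eqxx /=; apply/eqP/size0nil; rewrite size_canon.
by case: execs.
Qed.

(** * The spectral property implies irreducibility *)

(** If [a] never occurred from [al], then by accessibility it would occur in no execution at all,
    and removing it would leave the characteristic root unchanged. *)
Lemma spectral_alive : accessible d -> spectral_property R I d -> alive d.
Proof.
move=> acc spec al a; apply: contrapT => nex.
have nota be w : Defs.act d (Some be) w <> None -> a \notin w.
  have [u du] := acc al be => dw; apply/negP => aw; apply: nex; exists (u ++ w).
  by rewrite mem_cat aw orbT act_cat du.
have := spec a; rewrite ltNge => /negP; apply.
rewrite le_eqVlt; apply/orP; left; apply/eqP; apply: eq_bigr => p _.
congr Defs.radius; apply/funext => n; rewrite /ntraces.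
congr #|pred_of_set (equivalence_partition _ _)|.
apply/finset.setP => w; rewrite !finset.in_set all_predT /=.
case: eqP => [dw|_]; rewrite ?andbF // andbT; apply/allP => b bw.
by apply: contraTneq bw => ->; apply: (nota p.1); rewrite dw.
Qed.

(** If [b] is outside the component [A] of [a], executions factor into an [A]-part without [b] and a
    rest without [a]. Strictly between $r$ and the smaller of $r^a$ and $r^b$ both factors have
    bounded sums, hence so does the whole system, a contradiction. *)
Lemma spectral_irreducible_monoid : spectral_property R I d -> irreducible_monoid I.
Proof.
move=> spec a b; apply: contrapT => /negP nab.
pose A x := connect (fun x y => ~~ I x y) a x.
have IA x y : A x -> ~~ A y -> I x y.
  move=> Ax; apply: contraNT => nI; exact: connect_trans Ax (connect1 nI).
have lt_min_root : (char_root R I d predT <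
    Order.min (char_root R I d (fun x => x != a)) (char_root R I d (fun x => x != b)))%E.
  by rewrite lt_min; apply/andP; split; [exact: spec a|exact: spec b].
have [rho [r0 lr rl]] := exists_between_ereal (char_root_ge0 predT) lt_min_root.
move: rl; rewrite lt_min => /andP[/(lt_char_root r0)[C1 C10 h1] /(lt_char_root r0)[C2 C20 h2]].
have := lr; apply/negP; rewrite -leNgt.
apply: (@le_char_root _ _ (\sum_(ga : X) C2 * C1)) => // al be N.
apply: le_trans (wsum_indep_factor I_sym d_bot d_comm r0 (P1 := fun x => x != b)
  (P2 := fun x => x != a) al be N IA _ _) _.
- by move=> x Ax; apply: contraTneq Ax => ->.
- by move=> x; apply: contraNneq => ->; exact: connect0.
- by apply: ler_sum => ga _; apply: ler_pM => //; exact: wsum_ge0.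
Qed.

End Radius.

Theorem theorem1 (R : realType) (Sigma : finType) (I : rel Sigma)
  (I_irrefl : irreflexive I) (I_sym : symmetric I)
  (X : finType) (X_nonempty : 0 < #|X|)
  (d : Sigma -> option X -> option X)
  (d_bot : forall a : Sigma, d a None = None)
  (d_comm : forall a b : Sigma, I a b -> forall s, d b (d a s) = d a (d b s)) :
  accessible d ->
  (irreducible_system I d <-> spectral_property R I d).
Proof.
move=> acc; split=> [irr a|spec].
  exact: (irreducible_char_root_lt R I_irrefl I_sym d_bot d_comm a X_nonempty irr).
split; first exact: acc.
  exact: (spectral_alive acc spec).
exact: (spectral_irreducible_monoid I_sym d_bot d_comm spec).
Qed.
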